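(* The index of contraction $\widehat{\operatorname{con}}\,B$ of a square substochastic matrix $B$ of order $n$ is computable in time linear in $n$ if $B$ is sparse and in time quadratic in $n$ if $B$ is dense. That is: there is an algorithm which, given a square substochastic matrix $B$ of order $n$ stored as a dense two-dimensional array, outputs $\widehat{\operatorname{con}}\,B\in\{0,1,2,\dots\}\cup\{\infty\}$ using $O(n^2)$ operations; and for each fixed constant $c$ there is an algorithm which, given a square substochastic matrix $B$ of order $n$ with at most $c$ nonzero entries per row stored in a sparse row format, outputs $\widehat{\operatorname{con}}\,B$ using $O(n)$ operations.
   Context: A substochastic matrix is a real matrix $B=(b_{ij})$ with $b_{ij}\ge 0$ for all $i,j$ and $\sum_j b_{ij}\le 1$ for all $i$. For a square matrix $B$ of order $n$, its digraph has vertex set $\{1,\dots,n\}$ and an edge $i\to j$ if and only if $b_{ij}\neq 0$. A walk is a nonempty finite sequence of consecutive edges $i_1\to i_2\to\cdots\to i_\ell$ ($\ell\ge 2$); its length $|p|$ is the number of edges $\ell-1$. Let $\hat J(B)=\{i:\sum_j b_{ij}<1\}$ and let $\hat P_i(B)$ be the set of walks in the digraph of $B$ with first vertex $i$ and last vertex in $\hat J(B)$. The index of contraction of $B$ is $$\widehat{\operatorname{con}}\,B=\max\Bigl(0,\ \sup_{i\notin\hat J(B)}\ \inf_{p\in\hat P_i(B)}|p|\Bigr),$$ where $i$ ranges over $\{1,\dots,n\}\setminus\hat J(B)$, and $\inf\emptyset=\infty$, $\sup\emptyset=-\infty$. Computational model: exact arithmetic, each addition or comparison of real numbers and each elementary random-access-machine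 step (array access, list append, queue enqueue/dequeue, integer operations) costs one operation. ''Sparse'' means that the maximum number of nonzero entries per row is bounded independently of $n$; a sparse row format (e.g. compressed sparse row) is one in which the nonzero entries of a given row, with their column indices, can be enumerated in time proportional to their number (up to an additive constant). *)

(* Defs.v *)
From mathcomp Require Import all_boot all_order all_algebra.
From mathcomp Require Import boolp classical_sets reals constructive_ereal ereal.
From mathcomp Require Import zify.

Set Implicit Arguments.
Unset Strict Implicit.
Unset Printing Implicit Defensive.

Import Order.TTheory GRing.Theory Num.Theory.

(** * Substochastic matrices and the index of contraction *)

Section Contraction.
Local Open Scope ring_scope.
Local Open Scope classical_set_scope.

Variables (R : realType) (n : nat) (B : 'M[R]_n).

Definition substochastic : Prop :=
  (forall i j, 0 <= B i j) /\ (forall i, \sum_j B i j <= 1).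

Definition edge : rel 'I_n := fun i j => B i j != 0.

Definition Jhat : {set 'I_n} := [set i | \sum_j B i j < 1]%SET.

(* A walk with first vertex [i] is represented by the sequence of its other
   vertices, so its length (number of edges) is the size of that sequence. *)
Definition Phat (i : 'I_n) : set (seq 'I_n) :=
  [set p | [/\ p <> [::], path edge i p & last i p \in Jhat]].

(* [ereal_inf set0 = +oo] and [ereal_sup set0 = -oo]. *)
Definition con : \bar R :=
  Order.max 0%E
    (ereal_sup [set ereal_inf [set ((size p)%:R)%:E | p in Phat i]
               | i in [set i | i \notin Jhat]]).

Definition row_sparse (c : nat) : Prop :=
  forall i, (#|[set j | (B i j != 0)%R]%SET| <= c)%N.

End Contraction.

(** * A random-access machine over the reals *)

(* Programs are finite syntax, and contain no real constants besides 0 and 1.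
   The memory consists of infinite arrays of natural numbers and infinite arrays
   of reals, both named by literals of the program; only the index in an array
   can be computed.  A register is cell 0 of an array.  The operations on reals
   are addition and comparison. *)

Inductive iexp : Type :=
| INum of nat
| IGet of nat & iexp
| IAdd of iexp & iexp
| ISub of iexp & iexp. (* truncated *)

Inductive rexp : Type :=
| RZero
| ROne
| RGet of nat & iexp
| RAdd of rexp & rexp.

Inductive bexp : Type :=
| BILe of iexp & iexp
| BRLe of rexp & rexp
| BNot of bexp
| BAnd of bexp & bexp.

(* [ISet a e f] is the assignment a[e] := f. *)
Inductive cmd : Type :=
| Skip
| ISet of nat & iexp & iexp
| RSet of nat & iexp & rexp
| Seq of cmd & cmd
| If of bexp & cmd & cmd
| While of bexp & cmd.

(* Every node of an expression costs one operation. *)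
Fixpoint icost (e : iexp) : nat :=
  match e with
  | INum _ => 1
  | IGet _ e1 => (icost e1).+1
  | IAdd e1 e2 | ISub e1 e2 => (icost e1 + icost e2).+1
  end.

Fixpoint rcost (e : rexp) : nat :=
  match e with
  | RZero | ROne => 1
  | RGet _ e1 => (icost e1).+1
  | RAdd e1 e2 => (rcost e1 + rcost e2).+1
  end.

Fixpoint bcost (e : bexp) : nat :=
  match e with
  | BILe e1 e2 => (icost e1 + icost e2).+1
  | BRLe e1 e2 => (rcost e1 + rcost e2).+1
  | BNot e1 => (bcost e1).+1
  | BAnd e1 e2 => (bcost e1 + bcost e2).+1
  end.

Section Semantics.
Variable R : realType.

Record memory : Type := Memory {
  imem : nat -> nat -> nat;
  rmem : nat -> nat -> R
}.

Definition iupd (m : memory) (a k v : nat) : memory :=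
  Memory (fun b l => if (b == a) && (l == k) then v else imem m b l) (rmem m).

Definition rupd (m : memory) (a k : nat) (v : R) : memory :=
  Memory (imem m) (fun b l => if (b == a) && (l == k) then v else rmem m b l).

Fixpoint ieval (m : memory) (e : iexp) : nat :=
  match e with
  | INum k => k
  | IGet a e1 => imem m a (ieval m e1)
  | IAdd e1 e2 => ieval m e1 + ieval m e2
  | ISub e1 e2 => ieval m e1 - ieval m e2
  end.

Fixpoint reval (m : memory) (e : rexp) : R :=
  match e with
  | RZero => 0%R
  | ROne => 1%R
  | RGet a e1 => rmem m a (ieval m e1)
  | RAdd e1 e2 => (reval m e1 + reval m e2)%R
  end.

Fixpoint beval (m : memory) (e : bexp) : bool :=
  match e with
  | BILe e1 e2 => ieval m e1 <= ieval m e2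
  | BRLe e1 e2 => (reval m e1 <= reval m e2)%R
  | BNot e1 => ~~ beval m e1
  | BAnd e1 e2 => beval m e1 && beval m e2
  end.

(* [exec p m t m']: started in memory [m], the program [p] halts in memory [m']
   after exactly [t] operations. *)
Inductive exec : cmd -> memory -> nat -> memory -> Prop :=
| exec_skip m : exec Skip m 1 m
| exec_iset a e f m :
    exec (ISet a e f) m (icost e + icost f).+1
         (iupd m a (ieval m e) (ieval m f))
| exec_rset a e f m :
    exec (RSet a e f) m (icost e + rcost f).+1
         (rupd m a (ieval m e) (reval m f))
| exec_seq p q m t m1 u m2 :
    exec p m t m1 -> exec q m1 u m2 -> exec (Seq p q) m (t + u) m2
| exec_if b p q m t m1 :
    exec (if beval m b then p else q) m t m1 ->
    exec (If b p q) m ((bcost b).+1 + t) m1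
| exec_while_end b p m :
    ~~ beval m b -> exec (While b p) m (bcost b).+1 m
| exec_while_step b p m t m1 u m2 :
    beval m b -> exec p m t m1 -> exec (While b p) m1 u m2 ->
    exec (While b p) m ((bcost b).+1 + t + u) m2.

Lemma exec_det p m t m1 u m2 :
  exec p m t m1 -> exec p m u m2 -> t = u /\ m1 = m2.
Proof.
move=> H; elim: H u m2 => {p m t m1}.
- by move=> m u m2 E; inversion E.
- by move=> a e f m u m2 E; inversion E.
- by move=> a e f m u m2 E; inversion E.
- move=> p q m t m1 u m2 _ IH1 _ IH2 v m3 E; inversion E; subst.
  match goal with H : exec p _ _ _ |- _ => case: (IH1 _ _ H) => -> ? end; subst.
  by match goal with H : exec q _ _ _ |- _ => case: (IH2 _ _ H) => -> -> end.
- move=> b p q m t m1 _ IH v m3 E; inversion E; subst.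
  match goal with H : exec (if _ then _ else _) _ _ _ |- _ =>
    by case: (IH _ _ H) => -> -> end.
- by move=> b p m /negP Nb v m3 E; inversion E; subst.
- move=> b p m t m1 u m2 Hb _ IH1 _ IH2 v m3 E; inversion E; subst.
    by match goal with H : is_true (~~ _) |- _ => rewrite Hb in H end.
  match goal with H : exec p _ _ _ |- _ => case: (IH1 _ _ H) => -> ? end; subst.
  match goal with H : exec (While _ _) _ _ _ |- _ =>
    by case: (IH2 _ _ H) => -> -> end.
Qed.

(* The output, a natural number or +oo, is read in array 1 of natural numbers:
   cell 0 is a flag for finiteness and cell 1 holds the finite value. *)
Definition output (m : memory) : \bar R :=
  if imem m 1 0 == 0 then ((imem m 1 1)%:R%R)%:E%E else +oo%E.

Definition outputs_within (p : cmd) (m : memory) (T : nat) (v : \bar R) : Prop :=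
  exists t m', [/\ exec p m t m', t <= T & output m' = v].

End Semantics.

(** * Storage of the input matrix *)

(* In both cases the order is in cell 0 of array 0 of natural numbers, and
   nothing is assumed about the rest of the memory. *)

Definition dense_stored (R : realType) (n : nat) (B : 'M[R]_n) (m : memory R) :
    Prop :=
  imem m 0 0 = n /\ (forall i j : 'I_n, rmem m 0 (i * n + j) = B i j).

Section Names.
Variable w : nat.

Fixpoint ibelow (e : iexp) : bool :=
  match e with
  | INum _ => true
  | IGet a e1 => (a < w) && ibelow e1
  | IAdd e1 e2 | ISub e1 e2 => ibelow e1 && ibelow e2
  end.

Fixpoint rbelow (e : rexp) : bool :=
  match e with
  | RZero | ROne => true
  | RGet a e1 => (a < w) && ibelow e1
  | RAdd e1 e2 => rbelow e1 && rbelow e2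
  end.

Fixpoint bbelow (e : bexp) : bool :=
  match e with
  | BILe e1 e2 => ibelow e1 && ibelow e2
  | BRLe e1 e2 => rbelow e1 && rbelow e2
  | BNot e1 => bbelow e1
  | BAnd e1 e2 => bbelow e1 && bbelow e2
  end.

Fixpoint below (p : cmd) : bool :=
  match p with
  | Skip => true
  | ISet a e f => [&& a < w, ibelow e & ibelow f]
  | RSet a e f => [&& a < w, ibelow e & rbelow f]
  | Seq p1 p2 => below p1 && below p2
  | If b p1 p2 => [&& bbelow b, below p1 & below p2]
  | While b p1 => bbelow b && below p1
  end.

Definition agree_below (R : realType) (m m' : memory R) : Prop :=
  forall a k, a < w -> imem m a k = imem m' a k /\ rmem m a k = rmem m' a k.

End Names.

Definition row_entries (R : realType) (n : nat) (B : 'M[R]_n) (i : 'I_n) :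
    seq (nat * R) :=
  [seq (nat_of_ord j, B i j) | j <- enum 'I_n & B i j != 0%R].

(* A sparse row format: a way of storing matrices in memory, together with a
   subroutine [enumerate] which, called with a row index in cell 0 of the array
   [row_arg], lists the nonzero entries of that row, in any order, in the arrays
   [col_res] (column indices) and [val_res] (values), puts their number in cell 0
   of [cnt_res], and takes time at most linear in that number.  The format and its
   subroutine use only arrays with names smaller than [width], which leaves
   the other ones to the caller. *)
Record sparse_row_format (R : realType) : Type := SparseRowFormat {
  stored : forall n : nat, 'M[R]_n -> memory R -> Prop;
  enumerate : cmd;
  row_arg : nat;
  cnt_res : nat;
  col_res : nat;
  val_res : nat;
  width : nat;
  slope : nat;
  offset : nat;
  stored_order : forall n (B : 'M[R]_n) m, stored B m -> imem m 0 0 = n;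
  stored_local : forall n (B : 'M[R]_n) m m',
    agree_below width m m' -> stored B m -> stored B m';
  enumerate_below : below width enumerate;
  enumerateP : forall n (B : 'M[R]_n) m (i : 'I_n), stored B m ->
    exists t m',
      [/\ exec enumerate (iupd m row_arg 0 i) t m',
          t <= slope * size (row_entries B i) + offset,
          stored B m' &
          perm_eq [seq (imem m' col_res k, rmem m' val_res k)
                  | k <- iota 0 (imem m' cnt_res 0)]
                  (row_entries B i)]
}.

(* Compressed sparse row is such a format: array 2 of natural numbers holds the
   row offsets, array 3 the column indices and array 1 of reals the values. *)
Section CSR.
Variable R : realType.

Definition csr_stored (n : nat) (B : 'M[R]_n) (m : memory R) : Prop :=
  [/\ imem m 0 0 = n, imem m 2 0 = 0 &
      forall i : 'I_n,
        imem m 2 i <= imem m 2 i.+1 /\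
        perm_eq [seq (imem m 3 k, rmem m 1 k)
                | k <- iota (imem m 2 i) (imem m 2 i.+1 - imem m 2 i)]
                (row_entries B i)].

Let row := IGet 4 (INum 0).
Let cnt := IGet 5 (INum 0).
Let pos := IAdd (IGet 2 row) cnt.

Definition csr_loop : cmd :=
  While (BNot (BILe (IGet 2 (IAdd row (INum 1))) pos))
    (Seq (ISet 6 cnt (IGet 3 pos))
    (Seq (RSet 2 cnt (RGet 1 pos))
         (ISet 5 (INum 0) (IAdd cnt (INum 1))))).

Definition csr_enumerate : cmd := Seq (ISet 5 (INum 0) (INum 0)) csr_loop.

Lemma csr_loopP r (m : memory R) (s := imem m 2 (imem m 4 0)) :
  imem m 2 (imem m 4 0 + 1) = s + imem m 5 0 + r ->
  exists t m',
    [/\ exec csr_loop m t m', t <= 60 * r + 60,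
        [/\ imem m' 0 = imem m 0, imem m' 2 = imem m 2, imem m' 3 = imem m 3
          & rmem m' 1 = rmem m 1],
        imem m' 5 0 = imem m 5 0 + r &
        forall k, (imem m' 6 k, rmem m' 2 k) =
          if imem m 5 0 <= k < imem m 5 0 + r
          then (imem m 3 (s + k), rmem m 1 (s + k))
          else (imem m 6 k, rmem m 2 k)].
Proof.
rewrite {}/s; elim: r m => [|r IH] m; set s := imem m 2 (imem m 4 0) => Hs.
  exists (bcost (BNot (BILe (IGet 2 (IAdd row (INum 1))) pos))).+1, m.
  split => //; last by move=> k; rewrite addn0 ltnNge andbN.
  - apply: exec_while_end; rewrite /= -/s negbK. lia.
  - by rewrite addn0.
set m1 := iupd m 6 (imem m 5 0) (imem m 3 (s + imem m 5 0)).
set m2 := rupd m1 2 (imem m 5 0) (rmem m 1 (s + imem m 5 0)).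
set m3 := iupd m2 5 0 (imem m 5 0 + 1).
have [|t [m' [E Ht [h0 h2 h3 h1] h5 hk]]] := IH m3.
  by rewrite /m3 /= -/s; lia.
eexists _, m'; split.
- apply: exec_while_step E.
    by rewrite /= -/s; lia.
  apply: (@exec_seq _ _ _ _ _ m1).
    exact: (@exec_iset _ 6 cnt (IGet 3 pos) m).
  apply: (@exec_seq _ _ _ _ _ m2); first exact: exec_rset.
  exact: (@exec_iset _ 5 (INum 0) (IAdd cnt (INum 1)) m2).
- by rewrite /=; lia.
- by rewrite h0 h2 h3 h1; split.
- by rewrite h5 /=; lia.
- move=> k; rewrite hk /=.
  have -> : imem m 5 0 + 1 <= k < imem m 5 0 + 1 + r =
            (imem m 5 0 < k < imem m 5 0 + r.+1) by lia.
  case: (ltngtP (imem m 5 0) k) => //= <-.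
  by rewrite addnS ltnS leq_addr.
Qed.

Lemma csr_local n (B : 'M[R]_n) m m' :
  agree_below 7 m m' -> csr_stored B m -> csr_stored B m'.
Proof.
move=> A [h0 h2 h]; split.
- by rewrite -(A 0 0 _).1.
- by rewrite -(A 2 0 _).1.
move=> i; rewrite -!(A 2 _ _).1 //; case: (h i) => le_i P; split=> //.
move: P; congr (is_true (perm_eq _ _)); apply: eq_map => k.
by rewrite (A 3 k _).1 // (A 1 k _).2.
Qed.

Lemma csr_enumerateP n (B : 'M[R]_n) m (i : 'I_n) : csr_stored B m ->
  exists t m',
    [/\ exec csr_enumerate (iupd m 4 0 i) t m',
        t <= 60 * size (row_entries B i) + 70,
        csr_stored B m' &
        perm_eq [seq (imem m' 6 k, rmem m' 2 k) | k <- iota 0 (imem m' 5 0)]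
                (row_entries B i)].
Proof.
move=> [h0 h2 h]; case: (h i) => le_i P.
set m1 := iupd (iupd m 4 0 i) 5 0 0.
have [|t [m' [E Ht [g0 g2 g3 g1] g5 gk]]] :=
  @csr_loopP (imem m 2 i.+1 - imem m 2 i) m1.
  by rewrite /= addn0 addn1 subnKC.
exists (3 + t), m'; split.
- by apply: exec_seq E; exact: exec_iset.
- by rewrite -(perm_size P) size_map size_iota; lia.
- split; rewrite ?g0 ?g2 //= => j.
  by rewrite g3 g1; exact: h.
- rewrite g5 /= add0n; move: P; congr (is_true (perm_eq _ _)).
  rewrite -[X in iota X (_ - _)]addn0 iotaDl -map_comp.
  apply/eq_in_map => k; rewrite mem_iota add0n => /andP[_ lt_k].
  by rewrite gk /= add0n lt_k.
Qed.

Definition csr_format : sparse_row_format R.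
Proof.
refine (@SparseRowFormat R csr_stored csr_enumerate 4 5 6 2 7 60 70 _ _ _ _).
- by move=> n B m [].
- exact: csr_local.
- by [].
- exact: csr_enumerateP.
Defined.

End CSR.

(* Main.v *)
Require Import Defs.
From mathcomp Require Import all_boot all_order all_algebra.
From mathcomp Require Import boolp classical_sets reals constructive_ereal ereal.
From mathcomp Require Import zify.

(** The index of contraction is the largest distance, in the digraph, from a
    vertex to the set of rows with sum less than 1.  One pass over the rows computes
    their sums and records each edge in the list of predecessors of its end; a
    breadth-first search from all the rows of sum less than 1 along reversed edges
    then finds the distances in nondecreasing order, so the answer is the distance
    of the last vertex found, or infinity if some vertex is missed.  This takes
    O(n (D + e + 1)) operations if a row has at most [e] nonzero entries and can be
    enumerated in time [D].  For a sparse format [D] and [e] are constants; in a dense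
    array a row is enumerated by scanning it, so that both are O(n). *)

Set Implicit Arguments.
Unset Strict Implicit.
Unset Printing Implicit Defensive.

Import Order.TTheory GRing.Theory Num.Theory.

(** * Running time and postconditions of programs *)

Section Runs.
Variable R : realType.
Implicit Types (m : memory R) (p q : cmd).

(** Total correctness: halting is part of the claim, and [Q] constrains the running time along with
    the final memory. *)
Definition runs p m (Q : nat -> memory R -> Prop) : Prop :=
  exists t m', exec p m t m' /\ Q t m'.

Lemma runs_weaken p m (Q Q' : nat -> memory R -> Prop) :
  (forall t m', Q t m' -> Q' t m') -> runs p m Q -> runs p m Q'.
Proof. by move=> QQ' [t [m' [E /QQ' q]]]; exists t, m'. Qed.

(** Computes by simplification on loop-free code; at a loop it falls back on [runs], to be settled
    by an invariant. *)
Fixpoint wp p m (Q : nat -> memory R -> Prop) : Prop :=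
  match p with
  | Skip => Q 1 m
  | ISet a e f => Q (icost e + icost f).+1 (iupd m a (ieval m e) (ieval m f))
  | RSet a e f => Q (icost e + rcost f).+1 (rupd m a (ieval m e) (reval m f))
  | Seq p q => wp p m (fun t m1 => wp q m1 (fun u m2 => Q (t + u) m2))
  | If b p q => if beval m b then wp p m (fun t => Q ((bcost b).+1 + t))
                else wp q m (fun t => Q ((bcost b).+1 + t))
  | While b p => runs (While b p) m Q
  end.

Lemma wp_runs p m Q : wp p m Q -> runs p m Q.
Proof.
elim: p m Q => //=.
- by move=> m Q q; exists 1, m; split=> //; constructor.
- by move=> a e f m Q q; do 2 eexists; split; [constructor|].
- by move=> a e f m Q q; do 2 eexists; split; [constructor|].
- move=> p IHp q IHq m Q /IHp[t [m1 [Ep /IHq[u [m2 [Eq qQ]]]]]].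
  by exists (t + u), m2; split=> //; apply: exec_seq Ep Eq.
- move=> b p IHp q IHq m Q; case: ifP => Hb.
    move=> /IHp[t [m1 [E qQ]]]; exists ((bcost b).+1 + t), m1; split=> //.
    by apply: exec_if; rewrite Hb.
  move=> /IHq[t [m1 [E qQ]]]; exists ((bcost b).+1 + t), m1; split=> //.
  by apply: exec_if; rewrite Hb.
Qed.

Lemma runs_seq p q m Q :
  runs p m (fun t m1 => runs q m1 (fun u m2 => Q (t + u) m2)) ->
  runs (Seq p q) m Q.
Proof.
move=> [t [m1 [Ep [u [m2 [Eq qQ]]]]]].
by exists (t + u), m2; split=> //; apply: exec_seq Ep Eq.
Qed.

(* [s] is a ghost state, and [pot] pays in advance for the rest of the loop. *)
Lemma runs_while (A : Type) (pot : A -> nat) (I : A -> memory R -> Prop) b p :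
  (forall s m, I s m -> beval m b ->
     runs p m (fun t m' =>
       exists s', I s' m' /\ t + (bcost b).+1 + pot s' <= pot s)) ->
  forall s m, I s m ->
  runs (While b p) m (fun t m' =>
    t <= pot s + (bcost b).+1 /\ exists s', I s' m' /\ ~~ beval m' b).
Proof.
(* Every iteration pays at least the positive cost of the guard, so the potential strictly decreases
   and induction on it also yields termination. *)
move=> step s m; have [N] := ubnP (pot s); elim: N s m => // N IH s m ltN Is.
case Hb: (beval m b); last first.
  exists (bcost b).+1, m; split; first by apply: exec_while_end; rewrite Hb.
  by split; [lia | exists s; rewrite Hb].
have [t [m1 [E [s1 [Is1 le1]]]]] := step s m Is Hb.
have [|u [m2 [E2 [le2 ex2]]]] := IH s1 m1 _ Is1; first by lia.
exists ((bcost b).+1 + t + u), m2; split; first exact: exec_while_step E E2.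
by split=> //; lia.
Qed.

Definition agree_above w m m' : Prop :=
  forall a, w <= a -> imem m a = imem m' a /\ rmem m a = rmem m' a.

(** A program writes only to arrays that it names; hence the caller's arrays survive the row
    subroutine. *)
Lemma exec_below w p m t m' :
  below w p -> exec p m t m' -> agree_above w m m'.
Proof.
move=> Bp E; elim: E Bp => {p m t m'} //=.
- move=> a e f m /andP[lt_a _] b le_b; split=> //=.
  by apply/funext=> l; have -> : b == a = false by lia.
- move=> a e f m /andP[lt_a _] b le_b; split=> //=.
  by apply/funext=> l; have -> : b == a = false by lia.
- move=> p q m t m1 u m2 _ IH1 _ IH2 /andP[/IH1 h1 /IH2 h2] b le_b.
  by have [-> ->] := h1 b le_b; exact: h2.
- move=> b p q m t m1 _ IH /and3P[_ Bp Bq]; apply: IH.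
  by case: ifP.
- move=> b p m t m1 u m2 _ _ IH1 _ IH2 /andP[Bb Bp] a le_a.
  have [-> ->] := IH1 Bp a le_a; apply: IH2 => //.
  by rewrite Bb.
Qed.

Lemma agree_below_iupd w m m' a k v :
  w <= a -> agree_below w m m' -> agree_below w m (iupd m' a k v).
Proof.
move=> le_a A b l lt_b; have [-> ->] := A b l lt_b; split=> //=.
by have -> : b == a = false by lia.
Qed.

Lemma agree_below_rupd w m m' a k v :
  w <= a -> agree_below w m m' -> agree_below w m (rupd m' a k v).
Proof.
move=> le_a A b l lt_b; have [-> ->] := A b l lt_b; split=> //=.
by have -> : b == a = false by lia.
Qed.

End Runs.

(** * Breadth-first search *)

Definition preds (es : seq (nat * nat)) (v : nat) : seq nat :=
  [seq e.1 | e <- es & e.2 == v].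

Lemma mem_preds (es : seq (nat * nat)) v a : (a \in preds es v) = ((a, v) \in es).
Proof.
apply/mapP/idP => [[[x y]]|av]; last by exists (a, v); rewrite ?mem_filter ?eqxx.
by rewrite mem_filter /= => /andP[/eqP-> xy] ->.
Qed.

Section BreadthFirst.
Variables (n : nat) (es : seq (nat * nat)) (src : seq nat).
Hypothesis es_lt : forall e, e \in es -> e.1 < n.

Fixpoint reach k a : Prop :=
  if k is k'.+1 then exists2 b, (a, b) \in es & reach k' b else a \in src.

(* [P] is the list of the vertices already scanned, [W] the queue, [d] the
   distance, [rest] the predecessors, still to be scanned, of the last vertex of
   [P], and [dv] its distance. *)
Record bfs_inv (P W : seq nat) (d : nat -> nat) (dv : nat) (rest : seq nat) :
    Prop := BfsInv {
  bfs_uniq : uniq (P ++ W);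
  bfs_lt : forall a, a \in P ++ W -> a < n;
  bfs_src : forall a, a \in src -> a \in P ++ W /\ d a = 0;
  bfs_sound : forall a, a \in P ++ W -> reach (d a) a;
  bfs_sorted : sorted leq [seq d a | a <- P ++ W];
  bfs_queue : forall a, a \in W -> dv <= d a;
  bfs_le : forall a, a \in P ++ W -> d a <= dv.+1;
  bfs_rest : forall a, a \in rest -> a < n /\ reach dv.+1 a;
  bfs_closed : forall a b, b \in P -> (a, b) \in es ->
    (a \in P ++ W /\ d a <= (d b).+1) \/ (a \in rest /\ d b = dv)
}.

Lemma bfs_init : uniq src -> (forall a, a \in src -> a < n) ->
  bfs_inv [::] src (fun=> 0) 0 [::].
Proof.
move=> U lt; split=> //=.
by elim: (src) => //= a [|b s].
Qed.

(** No found vertex has distance above [dv.+1], so every edge waiting on [a] already satisfies the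
    first alternative of [bfs_closed]. *)
Lemma bfs_skip P W d dv a rest : a \in P ++ W ->
  bfs_inv P W d dv (a :: rest) -> bfs_inv P W d dv rest.
Proof.
move=> Pa [U lt Hs S So Qu L Re C]; split=> //.
  by move=> x Hx; apply: Re; rewrite in_cons Hx orbT.
move=> x y Py xy; have [|[]] := C x y Py xy; first by left.
rewrite in_cons => /orP[/eqP->|Hx] dy; last by right.
by left; split=> //; rewrite dy; exact: L.
Qed.

Lemma sorted_rcons_leq (s : seq nat) a :
  sorted leq s -> (forall x, x \in s -> x <= a) -> sorted leq (rcons s a).
Proof.
case: s => //= b s Ps Ha; rewrite rcons_path Ps /=.
by apply: Ha; exact: mem_last.
Qed.

(** All distances so far are at most [dv.+1], so a new vertex at this distance can join the end of
    the queue without breaking the order. *)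
Lemma bfs_push P W d dv a rest : a \notin P ++ W ->
  bfs_inv P W d dv (a :: rest) ->
  bfs_inv P (rcons W a) (fun x => if x == a then dv.+1 else d x) dv rest.
Proof.
move=> Pa [U lt Hs S So Qu L Re C].
have [lta ra] := Re a (mem_head _ _).
have dE x : x \in P ++ W -> (if x == a then dv.+1 else d x) = d x.
  by move=> Hx; case: eqP Hx Pa => // -> ->.
have memE x : x \in P ++ rcons W a = (x == a) || (x \in P ++ W).
  by rewrite -rcons_cat mem_rcons in_cons.
split.
- by rewrite -rcons_cat rcons_uniq Pa.
- by move=> x; rewrite memE => /orP[/eqP->|/lt].
- by move=> x /Hs[Hx dx]; rewrite memE Hx orbT dE.
- move=> x; rewrite memE; case: eqP => [-> _|_ /= Hx]; [exact: ra | exact: S].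
- rewrite -rcons_cat map_rcons eqxx; apply: sorted_rcons_leq.
    by rewrite (eq_in_map _ d _).1.
  by move=> _ /mapP[x Hx ->]; rewrite dE //; exact: L.
- move=> x; rewrite mem_rcons in_cons; case: eqP => //= _; exact: Qu.
- move=> x; rewrite memE; case: eqP => //= _; exact: L.
- by move=> x Hx; apply: Re; rewrite in_cons Hx orbT.
- move=> x y Py xy.
  have dE_y : (if y == a then dv.+1 else d y) = d y by rewrite dE ?mem_cat ?Py.
  rewrite dE_y memE.
  have [[Hx le_x]|[]] := C x y Py xy; first by left; rewrite Hx orbT dE.
  rewrite in_cons; case: eqP => [-> _ ->|_ /= Hx dy]; first by left.
  by right.
Qed.

(** With [rest] empty, every edge into [P] is settled. By sortedness [u] is nearest in the queue,
    and [d u] is at least [dv], which preserves the bound on all distances. *)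
Lemma bfs_dequeue P W d dv u : bfs_inv P (u :: W) d dv [::] ->
  bfs_inv (rcons P u) W d (d u) (preds es u).
Proof.
move=> [U lt Hs S So Qu L Re C].
have Pu : u \in P ++ u :: W by rewrite mem_cat mem_head orbT.
split; rewrite ?cat_rcons //.
- move=> x Wx; move: So; rewrite map_cat /= => /cat_sorted2[_].
  rewrite /= path_sortedE; last exact: leq_trans.
  by move=> /andP[/allP le_u _]; apply: le_u; exact: map_f.
- move=> x /L le_x; apply: (leq_trans le_x); rewrite ltnS; apply: Qu.
  exact: mem_head.
- move=> x; rewrite mem_preds => xu; split; first exact: es_lt xu.
  by exists u => //; exact: S.
- move=> x y; rewrite mem_rcons in_cons => /orP[/eqP-> xu|Py xy].
    by right; rewrite mem_preds.
  by left; have [|[]] := C x y Py xy.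
Qed.

(** Once nothing waits, an edge into a found vertex starts at a found vertex at most one step
    farther; this propagates along walks. Together with [bfs_sound] it makes [d] the distance. *)
Lemma bfs_finish P d dv : bfs_inv P [::] d dv [::] ->
  forall k a, reach k a -> a \in P /\ d a <= k.
Proof.
move=> [U lt Hs S So Qu L Re C]; rewrite cats0 in Hs C.
elim=> [|k IH] a /=; first by move=> /Hs[-> ->].
move=> [b ab /IH[Pb le_b]].
by have [[-> le_a]|[]//] := C a b Pb ab; split=> //; lia.
Qed.

Lemma size_bfs P W d dv rest : bfs_inv P W d dv rest -> size (P ++ W) <= n.
Proof.
move=> [U lt _ _ _ _ _ _ _]; rewrite -(size_iota 0 n); apply: uniq_leq_size => //.
by move=> x /lt; rewrite mem_iota.
Qed.

(** Bounds the remaining passes: predecessors pending, edges into vertices not yet scanned, and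
    those vertices themselves. *)
Definition bfs_pot (P rest : seq nat) : nat :=
  size rest + count (fun e => e.2 \notin P) es + (n - size P).

(** The edges into [u], which is not in [P], move from the second term to the first; the third,
    positive by [size_bfs], drops by one. *)
Lemma bfs_pot_dequeue P W d dv u : bfs_inv P (u :: W) d dv [::] ->
  bfs_pot P [::] = (bfs_pot (rcons P u) (preds es u)).+1.
Proof.
move=> I; have := size_bfs I; have := bfs_uniq I.
rewrite cat_uniq size_cat /= negb_or => /and3P[_ /andP[Pu _] _] le_n.
rewrite /bfs_pot size_map size_filter size_rcons.
suff -> : count (fun e => e.2 \notin P) es =
          count (fun e => e.2 == u) es + count (fun e => e.2 \notin rcons P u) es.
  rewrite /=; set x := count _ _; set y := count _ _.
  lia.
elim: (es) => //= e s ->; rewrite mem_rcons in_cons.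
case: eqP => [->|_] /=; last by case: (_ \notin _) => /=; lia.
by rewrite Pu /=; lia.
Qed.

End BreadthFirst.

(** * The index of contraction as a largest distance *)

Section IndexOfContraction.
Variables (R : realType) (n : nat) (B : 'M[R]_n).
Variables (es : seq (nat * nat)) (src : seq nat).
Hypothesis es_lt : forall e, e \in es -> e.2 < n.
Hypothesis mem_es : forall i j : 'I_n, ((val i, val j) \in es) = edge B i j.
Hypothesis mem_src : forall i : 'I_n, (val i \in src) = (i \in Jhat B).

Lemma walk_reach (i : 'I_n) p :
  path (edge B) i p -> last i p \in Jhat B -> reach es src (size p) (val i).
Proof.
elim: p i => [|j p IH] i /=; first by rewrite mem_src.
by move=> /andP[ij Pp] /(IH _ Pp) rj; exists (val j); rewrite ?mem_es.
Qed.

Lemma reach_walk k (i : 'I_n) : reach es src k (val i) ->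
  exists p, [/\ path (edge B) i p, last i p \in Jhat B & size p = k].
Proof.
elim: k i => [|k IH] i /=; first by rewrite mem_src => Ji; exists [::].
move=> [b ib]; have lt_b := es_lt ib.
rewrite -[b]/(val (Ordinal lt_b)) => /IH[p [Pp Jp <-]].
by exists (Ordinal lt_b :: p); split=> //=; rewrite Pp -mem_es ib.
Qed.

(** From outside [Jhat B] only a nonempty walk can end in [Jhat B], as [Phat] demands. *)
Lemma reach_Phat k (i : 'I_n) : i \notin Jhat B -> reach es src k (val i) ->
  exists2 p, Phat B i p & size p = k.
Proof.
move=> NJ /reach_walk[p [Pp Jp <-]]; exists p => //; split=> // p0.
by move: Jp NJ; rewrite p0 /= => ->.
Qed.

(** [d] is the distance to the sources, so each infimum equals [d i], and a farthest vertex [top]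
    governs the supremum. *)
Lemma con_fin (d : nat -> nat) (top : 'I_n) :
  (forall i : 'I_n, reach es src (d i) i) ->
  (forall (i : 'I_n) k, reach es src k i -> d i <= k) ->
  (forall i : 'I_n, d i <= d top) ->
  con B = ((d top)%:R%R)%:E%E.
Proof.
move=> rd dmin dtop.
have infE (i : 'I_n) : i \notin Jhat B ->
    ereal_inf [set ((size p)%:R%R : R)%:E%E | p in Phat B i]%classic
    = ((d i)%:R%R)%:E%E.
  move=> NJ; apply/le_anti/andP; split.
    apply: ereal_inf_lbound; have [p Pp sp] := reach_Phat NJ (rd i).
    by exists p => //; rewrite sp.
  apply: le_ereal_inf_tmp => _ [p [_ Pp Jp] <-].
  by rewrite lee_fin ler_nat; apply: dmin; exact: walk_reach.
have d0 (i : 'I_n) : i \in Jhat B -> d i = 0.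
  by rewrite -mem_src => /(dmin i 0); lia.
have ge0 : (0 <= ((d top)%:R%R : R)%:E)%E by rewrite lee_fin ler0n.
apply/le_anti/andP; split; rewrite /con.
  rewrite ge_max ge0 /=; apply: ge_ereal_sup => _ [i /= NJ <-].
  by rewrite infE // lee_fin ler_nat.
(* The supremum omits [top] when it lies in [Jhat B]; then [d top] is 0 and the maximum with 0
   supplies the value. *)
rewrite le_max; have [Jt|NJ] := boolP (top \in Jhat B).
  by rewrite (d0 _ Jt) lexx.
apply/orP; right; apply: ereal_sup_ubound; exists top => //; exact: infE.
Qed.

Lemma con_infty (i : 'I_n) : (forall k, ~ reach es src k i) -> con B = +oo%E.
Proof.
move=> Ni; have NJ : i \notin Jhat B by rewrite -mem_src; apply/negP => /(Ni 0).
suff -> : con B = Order.max 0%E +oo%E by rewrite maxey.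
congr Order.max; apply/eqP; rewrite -leye_eq; apply: ereal_sup_ubound.
exists i => //=.
suff -> : Phat B i = set0 by rewrite image_set0 ereal_inf0.
by rewrite -subset0 => p [_ Pp Jp]; exact: Ni _ (walk_reach Pp Jp).
Qed.

End IndexOfContraction.

(** * Data structures in memory *)

Definition upd (T : Type) (f : nat -> T) k v := fun l => if l == k then v else f l.

(* 0 is the null pointer; since pointers are at most [N], the cell [N.+1] is free. *)
Fixpoint linked (nx el : nat -> nat) N p (l : seq nat) : Prop :=
  if l is a :: l' then [/\ 0 < p <= N, el p = a & linked nx el N (nx p) l']
  else p = 0.

Lemma linked_upd nx el N p l x y :
  linked nx el N p l -> linked (upd nx N.+1 x) (upd el N.+1 y) N.+1 p l.
Proof.
elim: l p => //= a l IH p [le_p <- /IH L]; rewrite /upd.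
have -> : (p == N.+1) = false by lia.
by split=> //; lia.
Qed.

Definition graph_rep n (head nx el : nat -> nat) N (es : seq (nat * nat)) : Prop :=
  N = size es /\ forall v, v < n -> linked nx el (size es) (head v) (preds es v).

Lemma graph_rep_nil n head nx el :
  (forall v, v < n -> head v = 0) -> graph_rep n head nx el 0 [::].
Proof. by move=> h; split=> // v /h. Qed.

(** The new cell [N.+1] goes in front of list [j] with a link to the old head; being fresh, it
    disturbs no existing list. *)
Lemma graph_rep_push n head nx el N es i j :
  graph_rep n head nx el N es ->
  graph_rep n (upd head j N.+1) (upd nx N.+1 (head j)) (upd el N.+1 i) N.+1
    ((i, j) :: es).
Proof.
move=> [-> L]; split=> // v /L Lv.
have -> : upd head j (size es).+1 v = if v == j then (size es).+1 else head v by [].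
rewrite /preds /= [j == v]eq_sym.
case: eqP Lv => [->|_] Lv; last exact: linked_upd.
rewrite /=; split; rewrite ?ltnSn ?leqnn //.
  by rewrite /upd eqxx.
by rewrite {3}/upd eqxx; exact: linked_upd.
Qed.

(** [Q] lists all vertices ever enqueued, since dequeuing only advances the head; a zero in [dist]
    marks a vertex not yet found. *)
Definition queue_rep n (dist que : nat -> nat) qt (Q : seq nat) (d : nat -> nat) :
    Prop :=
  [/\ qt = size Q, forall k, k < size Q -> que k = nth 0 Q k &
      forall a, a < n -> dist a = if a \in Q then (d a).+1 else 0].

Lemma queue_rep_push n dist que qt (Q : seq nat) d (a : nat) x : a \notin Q ->
  queue_rep n dist que qt Q d ->
  queue_rep n (upd dist a x.+1) (upd que qt a) qt.+1 (rcons Q a)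
    (fun y => if y == a then x else d y).
Proof.
move=> Qa [-> hq hd]; split; first by rewrite size_rcons.
  move=> k; rewrite size_rcons nth_rcons /upd => lt_k.
  have [/hq|gt|_] := ltngtP k (size Q) => //; lia.
move=> b lt_b; rewrite mem_rcons in_cons /upd hd //.
by case: (b == a).
Qed.

Lemma queue_rep_ext n dist que qt Q d d' : d =1 d' ->
  queue_rep n dist que qt Q d -> queue_rep n dist que qt Q d'.
Proof. by move=> E [? ? h]; split=> // a /h ->; rewrite E. Qed.

(** * Edges and sources read off the rows *)

Section Scan.
Variables (R : realType) (n : nat) (B : 'M[R]_n) (e : nat).
Hypothesis row_le : forall i, size (row_entries B i) <= e.

(* The first [i] rows have been read: [es] lists their edges, and [src] those of
   their indices that are in [Jhat B]. *)
Record scanned i (es : seq (nat * nat)) (src : seq nat) : Prop := Scanned {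
  scanned_lt1 : forall x, x \in es -> x.1 < n;
  scanned_lt2 : forall x, x \in es -> x.2 < n;
  scanned_es : forall a b : 'I_n, ((val a, val b) \in es) = (a < i) && edge B a b;
  scanned_size : size es <= i * e;
  scanned_uniq : uniq src;
  scanned_src_lt : forall a, a \in src -> a < i;
  scanned_src : forall a : 'I_n, (val a \in src) = (a < i) && (a \in Jhat B)
}.

Lemma scanned0 : scanned 0 [::] [::].
Proof. by split. Qed.

Lemma row_entries_fst i (b : 'I_n) :
  (val b \in [seq x.1 | x <- row_entries B i]) = edge B i b.
Proof.
rewrite -map_comp (mem_map (f := val)); last exact: val_inj.
by rewrite !mem_filter -enumT mem_enum !andbT.
Qed.

Lemma sum_row_entries i :
  (\sum_(x <- row_entries B i) x.2 = \sum_j B i j)%R.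
Proof.
rewrite big_map big_filter big_enum_cond /= big_mkcond /=.
by apply: eq_bigr => j _; case: eqP.
Qed.

(** The order in which a row is listed affects neither its sum nor its set of edges; the reversal
    comes from pushing each edge in front of [es]. *)
Lemma scannedS (i : 'I_n) es src (l : seq (nat * R)) :
  perm_eq l (row_entries B i) -> scanned i es src ->
  scanned i.+1 (rev [seq (val i, x.1) | x <- l] ++ es)
    (if (1 <= \sum_(x <- l) x.2)%R then src else rcons src i).
Proof.
move=> Pl [lt1 lt2 hes sz U slt hs].
have Pf : perm_eq [seq x.1 | x <- l] [seq x.1 | x <- row_entries B i].
  exact: perm_map.
have -> : [seq (val i, x.1) | x <- l] = [seq (val i, b) | b <- [seq x.1 | x <- l]].
  by rewrite -map_comp.
have sumE : (1 <= \sum_(x <- l) x.2)%R = (i \notin Jhat B).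
  by rewrite (perm_big _ Pl) /= sum_row_entries inE real_leNgt ?num_real.
have ltE (a : 'I_n) : a != i -> (a <= i) = (a < i).
  by move=> ne_ai; rewrite leq_eqVlt (inj_eq val_inj) (negbTE ne_ai).
have Ni : val i \notin src by apply/negP => /slt; rewrite ltnn.
split.
- move=> x; rewrite mem_cat mem_rev => /orP[/mapP[y _ ->]|/lt1] //=.
- move=> x; rewrite mem_cat mem_rev => /orP[/mapP[y]|/lt2] //=.
  by rewrite (perm_mem Pf) => /mapP[_ /mapP[j _ ->] ->] -> /=.
- move=> a b; rewrite mem_cat mem_rev hes ltnS.
  have [->|ne_ai] := eqVneq a i.
    rewrite ltnn leqnn orbF (mem_map (f := pair (val i))); last by move=> ? ? [].
    by rewrite (perm_mem Pf) row_entries_fst.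
  rewrite (ltE _ ne_ai); case: mapP => //= -[y _ [/val_inj ai]].
  by rewrite ai eqxx in ne_ai.
- rewrite size_cat size_rev !size_map (perm_size Pl) mulSn.
  exact: leq_add (row_le i) sz.
- by case: ifP; rewrite // rcons_uniq U Ni.
- move=> a; case: ifP => _; first by move/slt; lia.
  by rewrite mem_rcons in_cons => /orP[/eqP->|/slt] //; lia.
- move=> a; rewrite sumE ltnS.
  have -> : (val a \in if i \notin Jhat B then src else rcons src i)
          = ((a == i) && (i \in Jhat B)) || (val a \in src).
    case: ifP; first by move/negbTE->; rewrite andbF.
    by move/negbFE->; rewrite andbT mem_rcons in_cons (inj_eq val_inj).
  rewrite hs; have [->|ne_ai] := eqVneq a i; first by rewrite ltnn leqnn orbF.
  by rewrite (ltE _ ne_ai).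
Qed.

End Scan.

(** * The algorithm *)

Section Program.
Variables (w : nat) (enum : cmd) (arg cnt column value : nat).

(* Array [w] holds the registers: 0 the order, 1 the row index, 2 the position
   in the row, 3 the number of edges, 4 the end and 5 the head of the queue, 6
   the current list cell, 7 the current distance.  Arrays [w + 1], [w + 2] and
   [w + 3] hold the lists of predecessors: first cells, links and elements.
   Array [w + 4] holds the distances plus one (0 means unknown), and array
   [w + 5] the queue. *)
Definition get a e := IGet (w + a) e.
Definition put a e f := ISet (w + a) e f.
Definition reg k := get 0 (INum k).
Definition setreg k f := put 0 (INum k) f.
Definition succ e := IAdd e (INum 1).
Definition incr k := setreg k (succ (reg k)).
Definition ltexp e f := BNot (BILe f e).
Definition rowsum := RGet (w + 0) (INum 0).

(** The initial memory is arbitrary, so null list heads and unknown distances must be written out;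
    links, elements and queue cells are written before they are read. *)
Definition clear_loop : cmd :=
  While (ltexp (reg 1) (reg 0))
    (Seq (put 1 (reg 1) (INum 0))
    (Seq (put 4 (reg 1) (INum 0))
         (incr 1))).

(** The edge counter is incremented before it serves as a cell number, so cell 0 stays free for the
    null pointer. *)
Definition entry_loop : cmd :=
  While (ltexp (reg 2) (IGet cnt (INum 0)))
    (Seq (incr 3)
    (Seq (put 2 (reg 3) (get 1 (IGet column (reg 2))))
    (Seq (put 3 (reg 3) (reg 1))
    (Seq (put 1 (IGet column (reg 2)) (reg 3))
    (Seq (RSet (w + 0) (INum 0) (RAdd rowsum (RGet value (reg 2))))
         (incr 2)))))).

(** Rows of sum less than 1 are enqueued at once with stored value 1, that is distance 0, so the
    search starts with all sources queued. *)
Definition row_loop : cmd :=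
  While (ltexp (reg 1) (reg 0))
    (Seq (ISet arg (INum 0) (reg 1))
    (Seq enum
    (Seq (Seq (setreg 2 (INum 0)) (RSet (w + 0) (INum 0) RZero))
    (Seq entry_loop
    (Seq (If (BRLe ROne rowsum) Skip
             (Seq (put 4 (reg 1) (INum 1))
             (Seq (put 5 (reg 4) (reg 1))
                  (incr 4))))
         (incr 1)))))).

(** A single loop replaces two nested ones: each pass either dequeues a vertex or handles one list
    cell, in constant time. *)
Definition search_loop : cmd :=
  While (BNot (BAnd (BILe (reg 6) (INum 0)) (BILe (reg 4) (reg 5))))
    (If (BILe (reg 6) (INum 0))
        (Seq (setreg 7 (ISub (get 4 (get 5 (reg 5))) (INum 1)))
        (Seq (setreg 6 (get 1 (get 5 (reg 5))))
             (incr 5)))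
        (Seq (If (BILe (get 4 (get 3 (reg 6))) (INum 0))
                 (Seq (put 4 (get 3 (reg 6)) (succ (succ (reg 7))))
                 (Seq (put 5 (reg 4) (get 3 (reg 6)))
                      (incr 4)))
                 Skip)
             (setreg 6 (get 2 (reg 6))))).

Definition answer : cmd :=
  If (BILe (reg 0) (reg 4))
     (Seq (ISet 1 (INum 1)
            (ISub (get 4 (get 5 (ISub (reg 0) (INum 1)))) (INum 1)))
          (ISet 1 (INum 0) (INum 0)))
     (ISet 1 (INum 0) (INum 1)).

Definition con_program : cmd :=
  Seq (Seq (setreg 0 (IGet 0 (INum 0))) (setreg 1 (INum 0)))
  (Seq clear_loop
  (Seq (Seq (setreg 1 (INum 0)) (Seq (setreg 3 (INum 0)) (setreg 4 (INum 0))))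
  (Seq row_loop
  (Seq (Seq (setreg 5 (INum 0)) (Seq (setreg 6 (INum 0)) (setreg 7 (INum 0))))
  (Seq search_loop answer))))).

(** * Correctness and running time *)

Section Correctness.
(** [D] bounds the time to enumerate a row, [e] the number of its nonzero entries, and [S] says that
    [B] is stored; dense and sparse storage are both instances. *)
Variables (R : realType) (n : nat) (B : 'M[R]_n) (D e : nat).
Variable (S : memory R -> Prop).
Hypothesis n_gt0 : 0 < n.
Hypothesis w_gt : [/\ 1 < w, arg < w, cnt < w, column < w & value < w].
Hypothesis enum_below : below w enum.
Hypothesis S_order : forall m, S m -> imem m 0 0 = n.
Hypothesis S_local : forall m m', agree_below w m m' -> S m -> S m'.
Hypothesis S_enum : forall m (i : 'I_n), S m -> exists t m',
  [/\ exec enum (iupd m arg 0 i) t m', t <= D, S m' &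
      perm_eq [seq (imem m' column k, rmem m' value k) | k <- iota 0 (imem m' cnt 0)]
              (row_entries B i)].
Hypothesis row_le : forall i, size (row_entries B i) <= e.

Lemma S_iupd m a k v : S m -> S (iupd m (w + a) k v).
Proof. by apply: S_local; apply: agree_below_iupd => //; exact: leq_addr. Qed.

Lemma clear_loopP m : S m -> imem m (w + 0) 0 = n -> imem m (w + 0) 1 = 0 ->
  runs clear_loop m (fun t m' => t <= 100 * n.+1 /\
    [/\ S m', imem m' (w + 0) 0 = n &
        forall a, a < n -> imem m' (w + 1) a = 0 /\ imem m' (w + 4) a = 0]).
Proof.
move=> Sm h0 h1.
pose I k m := [/\ S m, imem m (w + 0) 0 = n, imem m (w + 0) 1 = k, k <= n &
  forall a, a < k -> imem m (w + 1) a = 0 /\ imem m (w + 4) a = 0].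
have I0 : I 0 m by [].
apply: runs_weaken (runs_while (pot := fun k => 50 * (n - k)) (I := I) _ I0).
  move=> t m' [le_t [k [[Sm' g0 g1 le_k hk]]]]; rewrite /= g0 g1 => Nk.
  split; first by move: le_t => /=; lia.
  by split=> // a lt_a; apply: hk; lia.
move=> k m1 [Sm' g0 g1 le_k hk] /=; rewrite g0 g1 => lt_k.
apply: wp_runs => /=; rewrite !eqn_add2l /= g1.
exists k.+1; split; last by lia.
split=> /=; rewrite ?eqn_add2l /= ?g1 //; try lia.
  by do 3 apply: S_iupd.
move=> a lt_a; rewrite ?eqn_add2l /=; case: eqP => // ne_a.
by apply: hk; lia.
Qed.

Lemma below_neq a k : a < w -> (a == w + k) = false.
Proof. lia. Qed.

Lemma entry_loopP (m : memory R) i es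
    (f := fun k => (imem m column k, rmem m value k)) (c := imem m cnt 0) :
  imem m (w + 0) 1 = i -> imem m (w + 0) 2 = 0 -> rmem m (w + 0) 0 = 0%R ->
  graph_rep n (imem m (w + 1)) (imem m (w + 2)) (imem m (w + 3))
    (imem m (w + 0) 3) es ->
  runs entry_loop m (fun t m' => t <= 100 * c.+1 /\
    [/\ [/\ agree_below w m m',
          forall k, k \notin [:: 2; 3] -> imem m' (w + 0) k = imem m (w + 0) k,
          imem m' (w + 4) = imem m (w + 4) & imem m' (w + 5) = imem m (w + 5)],
        graph_rep n (imem m' (w + 1)) (imem m' (w + 2)) (imem m' (w + 3))
          (imem m' (w + 0) 3) (rev [seq (i, x.1) | x <- mkseq f c] ++ es) &
        rmem m' (w + 0) 0 = (\sum_(x <- mkseq f c) x.2)%R]).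
Proof.
move=> h1 h2 hs hg; have [w1 wa wn wc wv] := w_gt.
(* An opaque [l], known by its recursion equations, replaces [mkseq f] in the goal. *)
have [l [l0 lS <-]] : exists l, [/\ l 0 = [::],
    forall k, l k.+1 = rcons (l k) (f k) & l = mkseq f].
  by exists (mkseq f); split=> // k; exact: mkseqS.
pose I k m' := [/\ k <= c, imem m' (w + 0) 2 = k,
  [/\ agree_below w m m',
      forall k, k \notin [:: 2; 3] -> imem m' (w + 0) k = imem m (w + 0) k,
      imem m' (w + 4) = imem m (w + 4) & imem m' (w + 5) = imem m (w + 5)],
  graph_rep n (imem m' (w + 1)) (imem m' (w + 2)) (imem m' (w + 3))
    (imem m' (w + 0) 3) (rev [seq (i, x.1) | x <- l k] ++ es) &
  rmem m' (w + 0) 0 = (\sum_(x <- l k) x.2)%R].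
have I0 : I 0 m by split; rewrite ?l0 //= big_nil.
apply: runs_weaken (runs_while (pot := fun k => 80 * (c - k)) (I := I) _ I0).
  move=> t m' [le_t [k [[le_k g2 [A gr g4 g5] gg gs]]]].
  rewrite /= g2 -(A cnt 0 wn).1 => Nk.
  have kE : k = c by move: le_k Nk; rewrite /c; lia.
  rewrite -kE; split; first by move: le_t => /=; lia.
  by split.
move=> k m1 [le_k g2 [A gr g4 g5] gg gs] /=; rewrite g2 -(A cnt 0 wn).1 => lt_k.
have lt_kc : k < c by move: lt_k; rewrite /c; lia.
apply: wp_runs => /=; rewrite !(eqn_add2l, below_neq) //= g2 (gr 1) // h1.
exists k.+1; split; last by lia.
rewrite -(A column k wc).1 -(A value k wv).2.
split=> /=; rewrite ?eqn_add2l /= ?g2 ?(addn1 k) ?(addn1 (imem m1 _ _)) //.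
- split=> //.
  + by do ?[apply: agree_below_iupd; first exact: leq_addr
           |apply: agree_below_rupd; first exact: leq_addr].
  + move=> r; rewrite !inE negb_or => /andP[/negbTE r2 /negbTE r3].
    by rewrite r2 r3 gr // !inE r2 r3.
- rewrite lS map_rcons rev_rcons cat_cons.
  have := graph_rep_push i (imem m column k) gg.
  by [].
- by rewrite lS -cats1 big_cat big_seq1 /= -gs.
Qed.

Lemma row_loopP m :
  S m -> imem m (w + 0) 0 = n -> imem m (w + 0) 1 = 0 ->
  imem m (w + 0) 3 = 0 -> imem m (w + 0) 4 = 0 ->
  (forall a, a < n -> imem m (w + 1) a = 0 /\ imem m (w + 4) a = 0) ->
  runs row_loop m (fun t m' => t <= n * (300 + D + 100 * e) + 100 /\
    imem m' (w + 0) 0 = n /\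
    exists es src, [/\ scanned B e n es src,
      graph_rep n (imem m' (w + 1)) (imem m' (w + 2)) (imem m' (w + 3))
        (imem m' (w + 0) 3) es &
      queue_rep n (imem m' (w + 4)) (imem m' (w + 5)) (imem m' (w + 0) 4) src
        (fun=> 0)]).
Proof.
move=> Sm h0 h1 h3 h4 hz; have [w1 wa wn wc wv] := w_gt.
pose I (s : nat * seq (nat * nat) * seq nat) m' :=
  [/\ S m', imem m' (w + 0) 0 = n, imem m' (w + 0) 1 = s.1.1, s.1.1 <= n &
   [/\ scanned B e s.1.1 s.1.2 s.2,
    graph_rep n (imem m' (w + 1)) (imem m' (w + 2)) (imem m' (w + 3))
      (imem m' (w + 0) 3) s.1.2 &
    queue_rep n (imem m' (w + 4)) (imem m' (w + 5)) (imem m' (w + 0) 4) s.2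
      (fun=> 0)]].
have I0 : I (0, [::], [::]) m.
  split=> //; split; first exact: scanned0.
    by rewrite h3; apply: graph_rep_nil => v /hz[].
  by rewrite h4; split=> // a /hz[_ ->].
apply: runs_weaken (runs_while
  (pot := fun s => (n - s.1.1) * (300 + D + 100 * e)) (I := I) _ I0).
  move=> t m' [le_t [[[i es] src] [[/= Sm' g0 g1 le_i [sc gr qu]]]]].
  rewrite g0 g1 => Ni; have iE : i = n by lia.
  split; first by move: le_t => /=; rewrite subn0; lia.
  by rewrite iE in sc; split=> //; exists es, src.
move=> [[i es] src] m1 [/= Sm1 g0 g1 le_i [sc gr qu]]; rewrite g0 g1 => lt_i.
have {}lt_i : i < n by lia.
apply: runs_seq; apply: wp_runs; rewrite /= g1.
apply: runs_seq; have [t [m2 [E le_t Sm2 P2]]] := S_enum (Ordinal lt_i) Sm1.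
exists t, m2; split; first exact: E.
(* The subroutine and its argument cell lie below [w], so the registers, lists and queue are
   unchanged by the call. *)
have A2 k : imem m2 (w + k) = imem m1 (w + k).
  have [<- _] := exec_below enum_below E (leq_addr k w).
  by apply/funext=> l /=; rewrite [w + k == arg]eq_sym below_neq.
apply: runs_seq; apply: wp_runs => /=.
set m3 := rupd _ _ _ _.
apply: runs_seq; apply: runs_weaken (@entry_loopP m3 i es _ _ _ _); last first.
- move: gr; rewrite -!A2 /m3 /=; rewrite !eqn_add2l /=; exact.
- by rewrite /m3 /= eqxx.
- by rewrite /m3 /= eqxx.
- by rewrite /m3 /= eqn_add2l /= A2.
move=> u m4 [le_u [[A34 rg g44 g45] gr4 sum4]].
have A23 : agree_below w m2 m3.
  apply: agree_below_rupd; first exact: leq_addr.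
  by apply: agree_below_iupd; first exact: leq_addr.
set l := mkseq _ _ in gr4 sum4.
have lE : l = [seq (imem m2 column k, rmem m2 value k) | k <- iota 0 (imem m2 cnt 0)].
  rewrite /l /mkseq -(A23 cnt 0 wn).1; apply: eq_map => k.
  by rewrite -(A23 column k wc).1 -(A23 value k wv).2.
rewrite -lE in P2; have sc' := scannedS row_le P2 sc.
have le_c : imem m3 cnt 0 <= e.
  by have := row_le (Ordinal lt_i); rewrite -(perm_size P2) size_mkseq.
have Sm4 : S m4 by apply: S_local A34 _; exact: S_local A23 _.
have r0 : imem m4 (w + 0) 0 = n by rewrite rg //= eqn_add2l /= A2.
have r1 : imem m4 (w + 0) 1 = i by rewrite rg //= eqn_add2l /= A2.
have qu4 : queue_rep n (imem m4 (w + 4)) (imem m4 (w + 5)) (imem m4 (w + 0) 4)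
    src (fun=> 0).
  by rewrite g44 g45 rg //= !eqn_add2l /= !A2.
have bnd x (k := n - i.+1) : x <= 250 + D + 100 * imem m3 cnt 0 ->
    x + k * (300 + D + 100 * e) <= (n - i) * (300 + D + 100 * e).
  have -> : n - i = k.+1 by rewrite /k; lia.
  rewrite mulSn; lia.
apply: wp_runs => /=; rewrite sum4.
case: ifP sc' => _ sc'; rewrite ?eqn_add2l /= ?r1.
  exists (i.+1, rev [seq (i, x.1) | x <- l] ++ es, src); split; last first.
    by apply: bnd; lia.
  split=> /=; rewrite ?eqn_add2l /= ?(addn1 i) //; exact: S_iupd.
exists (i.+1, rev [seq (i, x.1) | x <- l] ++ es, rcons src i); split; last first.
  by apply: bnd; lia.
split=> /=; rewrite ?eqn_add2l /= ?(addn1 i) //; first by do 4 apply: S_iupd.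
split=> //; rewrite ?addn1.
have Ni : i \notin src by apply/negP => /(scanned_src_lt sc); rewrite ltnn.
(* Pushing at distance 0 yields the zero function only up to pointwise equality. *)
apply: queue_rep_ext (queue_rep_push 0 Ni qu4) => y.
by case: eqP.
Qed.

Lemma search_loopP (m : memory R) (es : seq (nat * nat)) (src : seq nat) :
  (forall x, x \in es -> x.1 < n) -> (forall x, x \in es -> x.2 < n) ->
  uniq src -> (forall a, a \in src -> a < n) ->
  imem m (w + 0) 0 = n -> imem m (w + 0) 5 = 0 -> imem m (w + 0) 6 = 0 ->
  imem m (w + 0) 7 = 0 ->
  graph_rep n (imem m (w + 1)) (imem m (w + 2)) (imem m (w + 3))
    (imem m (w + 0) 3) es ->
  queue_rep n (imem m (w + 4)) (imem m (w + 5)) (imem m (w + 0) 4) src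
    (fun=> 0) ->
  runs search_loop m (fun t m' => t <= 150 * (size es + n) + 100 /\
    imem m' (w + 0) 0 = n /\
    exists P d dv, bfs_inv n es src P [::] d dv [::] /\
      queue_rep n (imem m' (w + 4)) (imem m' (w + 5)) (imem m' (w + 0) 4) P d).
Proof.
move=> lt1 lt2 us slt h0 h5 h6 h7 hg hq.
(* The ghost state is the potential alone; the state of the search stays under the existential
   quantifier. *)
pose I s (m' : memory R) := exists P W d dv rest,
  [/\ s = bfs_pot n es P rest,
  [/\ imem m' (w + 0) 0 = n, imem m' (w + 0) 5 = size P & imem m' (w + 0) 7 = dv],
  [/\ imem m' (w + 1) = imem m (w + 1), imem m' (w + 2) = imem m (w + 2) &
      imem m' (w + 3) = imem m (w + 3)],
  linked (imem m (w + 2)) (imem m (w + 3)) (size es) (imem m' (w + 0) 6) rest &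
  bfs_inv n es src P W d dv rest /\
  queue_rep n (imem m' (w + 4)) (imem m' (w + 5)) (imem m' (w + 0) 4) (P ++ W) d].
have I0 : I (size es + n) m.
  exists [::], src, (fun=> 0), 0, [::]; split=> //; last first.
    by split=> //; exact: bfs_init.
  by rewrite /bfs_pot /= subn0 (eq_count (a2 := predT)) ?count_predT.
apply: runs_weaken (runs_while (pot := fun s => 150 * s) (I := I) _ I0).
  move=> t m' [le_t [s [[P [W [d [dv [rest]]]]]]]].
  move=> [sE [g0 g5 g7] _ L [inv qu]] /=; rewrite negbK => /andP[le6 le45].
  split; first by move: le_t => /=; lia.
  split=> //; exists P, d, dv.
  have r0 : rest = [::] by case: rest L {inv sE} => //= a rest []; lia.
  have W0 : W = [::].
    case: W qu {inv} => // a W [szQ _ _].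
    by move: le45; rewrite szQ g5 size_cat /=; lia.
  by move: inv qu; rewrite r0 W0 cats0.
move=> s m' [P [W [d [dv [rest [-> [g0 g5 g7] [g1 g2 g3] L [inv qu]]]]]]].
(* A null list pointer means that the predecessors are exhausted, and this pass dequeues. *)
rewrite /= => Hb; apply: wp_runs => /=; case: ifP => H6.
  have r0 : rest = [::] by case: rest L {inv} => //= a rest []; lia.
  rewrite {}r0 in inv L *.
  have [szQ hq' hd] := qu.
  case: W inv qu szQ hq' hd Hb => [|u W] inv qu szQ hq' hd.
    by rewrite H6 szQ g5 cats0 leqnn.
  move=> _; rewrite ?eqn_add2l /= g5.
  have uE : imem m' (w + 5) (size P) = u.
    by rewrite hq' ?size_cat ?nth_cat ?ltnn ?subnn //=; lia.
  have Pu : u \in P ++ u :: W by rewrite mem_cat mem_head orbT.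
  have ltu : u < n by exact: bfs_lt inv _ Pu.
  rewrite uE.
  exists (bfs_pot n es (rcons P u) (preds es u)); split; last first.
    by rewrite (bfs_pot_dequeue inv); lia.
  exists (rcons P u), W, d, (d u), (preds es u).
  split=> //=; rewrite ?eqn_add2l /= ?size_rcons ?cat_rcons ?(addn1 (size _)) //.
  - by split=> //; rewrite hd // Pu subn1.
  - by rewrite g1; apply: hg.2.
  - by split; [exact: (bfs_dequeue lt1 inv) | exact: qu].
case: rest inv L => [|a rest] inv /=; first by lia.
rewrite g3; case=> [le6 aE L]; rewrite aE.
have lta : a < n by have [] := bfs_rest inv (mem_head _ _).
have [szQ hq' hd] := qu.
have bndE : bfs_pot n es P (a :: rest) = (bfs_pot n es P rest).+1 by [].
(* A stored value 0 means that [a] is new and gets pushed; otherwise it is skipped. *)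
case: ifP => Ha; rewrite ?eqn_add2l /= bndE.
  have Qa : a \notin P ++ W by apply/negP => Qa; rewrite hd // Qa in Ha.
  exists (bfs_pot n es P rest); split; last by lia.
  exists P, (rcons W a), (fun x => if x == a then dv.+1 else d x), dv, rest.
  split=> //=; rewrite ?eqn_add2l /= ?g2 //.
  split; first exact: bfs_push.
  have := queue_rep_push dv.+1 Qa qu.
  by rewrite g7 aE rcons_cat (addn1 dv) (addn1 dv.+1) (addn1 (imem _ _ _)).
exists (bfs_pot n es P rest); split; last by lia.
have Qa : a \in P ++ W by apply: contraFT Ha => Qa; rewrite hd // (negbTE Qa).
exists P, W, d, dv, rest.
split=> //=; rewrite ?eqn_add2l /= ?g2 //.
by split; [exact: bfs_skip Qa inv | exact: qu].
Qed.

Lemma con_programP m :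
  S m -> outputs_within con_program m (1500 * (n * (D + e + 1))) (con B).
Proof.
move=> Sm; have [w1 _ _ _ _] := w_gt.
suff [t [m' [E [le_t O]]]] : runs con_program m (fun t m' =>
    t <= 1500 * (n * (D + e + 1)) /\ output m' = con B).
  by exists t, m'.
(* Positivity of [n] lets the product absorb the additive constant. *)
have bnd x : x <= 900 * n * (D + e + 1) + 600 -> x <= 1500 * (n * (D + e + 1)).
  have : 0 < n * (D + e + 1) by rewrite muln_gt0 n_gt0 addn1.
  rewrite -mulnA; lia.
apply: runs_seq; apply: wp_runs => /=.
rewrite (S_order Sm); set m1 := iupd _ _ _ _.
have Sm1 : S m1 by do 2 apply: S_iupd.
apply: runs_seq; apply: runs_weaken (clear_loopP Sm1 _ _); last first.
- by rewrite /m1 /= eqxx.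
- by rewrite /m1 /= eqxx.
move=> t2 m2 [le2 [Sm2 n2 z2]].
apply: runs_seq; apply: wp_runs => /=; set m3 := iupd _ _ _ _.
apply: runs_seq; apply: runs_weaken (row_loopP (m := m3) _ _ _ _ _ _);
  rewrite /m3 /= ?eqn_add2l ?eqxx //=; last by do 3 apply: S_iupd.
move=> t4 m4 [le4 [n4 [es [src [sc gr4 qu4]]]]].
apply: runs_seq; apply: wp_runs => /=; set m5 := iupd _ _ _ _.
apply: runs_seq; apply: runs_weaken (search_loopP (m := m5) (scanned_lt1 sc)
   (scanned_lt2 sc) (scanned_uniq sc) (scanned_src_lt sc) _ _ _ _ _ _);
  rewrite /m5 /= ?eqn_add2l ?eqxx //=.
move=> t6 m6 [le6 [n6 [P [d [dv [inv qu]]]]]].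
have mem_es (i j : 'I_n) : ((val i, val j) \in es) = edge B i j.
  by rewrite (scanned_es sc) ltn_ord.
have mem_src (i : 'I_n) : (val i \in src) = (i \in Jhat B).
  by rewrite (scanned_src sc) ltn_ord.
have conI := con_infty mem_es mem_src.
have conF := con_fin (scanned_lt2 sc) mem_es mem_src.
have le_es := scanned_size sc.
have [szQ hq hd] := qu.
have := size_bfs inv; rewrite cats0 => szP.
have U : uniq P by have := bfs_uniq inv; rewrite cats0.
have Plt a : a \in P -> a < n by move=> Pa; apply: (bfs_lt inv); rewrite cats0.
have dmin := bfs_finish inv.
apply: wp_runs => /=; rewrite n6 szQ.
have le_ne : n * (D + e + 1) = n * D + n * e + n by rewrite !mulnDr muln1.
have {}le4 : t4 <= 300 * n + n * D + 100 * (n * e) + 100.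
  by apply: leq_trans le4 _; rewrite !mulnDr; lia.
case: ifP => Hn; split; try by apply: bnd; rewrite -mulnA le_ne; lia.
(* At least [n] distinct numbers below [n] exhaust them all. *)
- have PE : P =i iota 0 n.
    have sub : {subset P <= iota 0 n} by move=> a /Plt; rewrite mem_iota.
    by apply: (uniq_min_size U sub _).2; rewrite size_iota.
  have allP (i : 'I_n) : val i \in P by rewrite PE mem_iota ltn_ord.
  have szE : size P = n by lia.
  have lt_n : n - 1 < size P by rewrite szE subn1 prednK.
  set top := nth 0 P (n - 1).
  have Ptop : top \in P by exact: mem_nth.
  have -> : imem m6 (w + 5) (n - 1) = top by exact: hq.
  rewrite hd ?Ptop ?(Plt _ Ptop) // subn1 /=.
  symmetry; rewrite /output /=.
  apply: (conF d (Ordinal (Plt _ Ptop))) => [i|i k /dmin[]//|i].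
    by apply: (bfs_sound inv); rewrite cats0; exact: allP.
  (* Distances are sorted along [P], so its last vertex is a farthest one. *)
  have := bfs_sorted inv; rewrite cats0 => so.
  have lt_i : index (val i) P < size P by rewrite index_mem.
  have := sorted_leq_nth leq_trans leqnn 0 so (index (val i) P) (n - 1).
  rewrite !inE size_map !(nth_map 0) // nth_index //.
  apply=> //; rewrite subn1 -ltnS prednK //.
  by apply: leq_trans lt_i _; rewrite szE.
(* Fewer than [n] vertices were found; by [dmin] a missed one has no walk to a source. *)
- have /allPn[i] : ~~ all (mem P) (iota 0 n).
    apply/allP => sub; move/negP: Hn; apply.
    by rewrite -(size_iota 0 n); apply: uniq_leq_size => //; exact: iota_uniq.
  rewrite mem_iota /= => lt_i Ni.
  rewrite (conI (Ordinal lt_i)) // => k /dmin[Pi _].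
  by move/negP: Ni; apply.
Qed.

End Correctness.
End Program.

(** * Row enumeration *)

Lemma size_row_entries (R : realType) n (B : 'M[R]_n) i :
  size (row_entries B i) = #|[set j | B i j != 0%R]%SET|.
Proof.
by rewrite size_map cardsE cardE enumT.
Qed.

Section BelowMonotone.
Variables (w w' : nat).
Hypothesis le_ww' : w <= w'.

Lemma ibelow_leq e : ibelow w e -> ibelow w' e.
Proof.
elim: e => //= [a e IH|e IHe f IHf|e IHe f IHf] /andP[].
- by move=> /leq_trans-> // /IH.
- by move=> /IHe-> /IHf.
- by move=> /IHe-> /IHf.
Qed.

Lemma rbelow_leq e : rbelow w e -> rbelow w' e.
Proof.
elim: e => //= [a e|e IHe f IHf] /andP[].
- by move=> /leq_trans-> // /ibelow_leq.
- by move=> /IHe-> /IHf.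
Qed.

Lemma bbelow_leq e : bbelow w e -> bbelow w' e.
Proof.
elim: e => //= [e f|e f|e IHe f IHf] /andP[].
- by move=> /ibelow_leq-> /ibelow_leq.
- by move=> /rbelow_leq-> /rbelow_leq.
- by move=> /IHe-> /IHf.
Qed.

(** The caller's arrays must start above the argument and result arrays too, which may exceed the
    format's [width]; hence the bound is raised. *)
Lemma below_leq p : below w p -> below w' p.
Proof.
elim: p => //= [a e f|a e f|p IHp q IHq|b p IHp q IHq|b p IHp].
- by move=> /and3P[/leq_trans-> // /ibelow_leq-> /ibelow_leq].
- by move=> /and3P[/leq_trans-> // /ibelow_leq-> /rbelow_leq].
- by move=> /andP[/IHp-> /IHq].
- by move=> /and3P[/bbelow_leq-> /IHp-> /IHq].
- by move=> /andP[/bbelow_leq-> /IHp].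
Qed.

End BelowMonotone.

(** * Rows of a dense two-dimensional array *)

Section Dense.

(* The machine has no multiplication: [offset_loop] adds up [i * n]. *)
Definition offset_loop : cmd :=
  While (BNot (BILe (IGet 2 (INum 0)) (IGet 6 (INum 0))))
    (Seq (ISet 5 (INum 0) (IAdd (IGet 5 (INum 0)) (IGet 0 (INum 0))))
         (ISet 6 (INum 0) (IAdd (IGet 6 (INum 0)) (INum 1)))).

Definition dense_entry : rexp :=
  RGet 0 (IAdd (IGet 5 (INum 0)) (IGet 6 (INum 0))).

(** Reals are compared only by [<=], so a zero entry is recognised by two comparisons. *)
Definition filter_loop : cmd :=
  While (BNot (BILe (IGet 0 (INum 0)) (IGet 6 (INum 0))))
    (Seq (If (BAnd (BRLe dense_entry RZero) (BRLe RZero dense_entry)) Skip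
             (Seq (ISet 4 (IGet 3 (INum 0)) (IGet 6 (INum 0)))
             (Seq (RSet 1 (IGet 3 (INum 0)) dense_entry)
                  (ISet 3 (INum 0) (IAdd (IGet 3 (INum 0)) (INum 1))))))
         (ISet 6 (INum 0) (IAdd (IGet 6 (INum 0)) (INum 1)))).

(** Array 2 holds the row index, 3 the count, 4 the columns and real array 1 the values; 5 and 6 are
    the row offset and the loop counter. *)
Definition dense_enumerate : cmd :=
  Seq (Seq (ISet 5 (INum 0) (INum 0)) (ISet 6 (INum 0) (INum 0)))
  (Seq offset_loop
  (Seq (Seq (ISet 3 (INum 0) (INum 0)) (ISet 6 (INum 0) (INum 0)))
       filter_loop)).

Variables (R : realType).
Implicit Types (m : memory R).

Lemma offset_loopP n i m : imem m 0 0 = n -> imem m 2 0 = i -> i <= n ->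
  imem m 5 0 = 0 -> imem m 6 0 = 0 ->
  runs offset_loop m (fun t m' => t <= 50 * n + 50 /\
    [/\ imem m' 0 = imem m 0, imem m' 5 0 = i * n & rmem m' 0 = rmem m 0]).
Proof.
move=> h0 h2 le_in h5 h6.
pose I k m' := [/\ k <= i, imem m' 6 0 = k, imem m' 2 0 = i &
  [/\ imem m' 0 = imem m 0, imem m' 5 0 = k * n & rmem m' 0 = rmem m 0]].
apply: runs_weaken (runs_while (pot := fun k => 50 * (i - k)) (I := I) (s := 0) _ _).
- move=> t m' [le_t [k [[le_k g6 g2 [g0 g5 gr]]]]] /=; rewrite g2 g6 => Nk.
  have <- : k = i by lia.
  by split=> //; move: le_t => /=; lia.
- move=> k m' [le_k g6 g2 [g0 g5 gr]] /=; rewrite g2 g6 => lt_k.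
  apply: wp_runs => /=; exists k.+1; split; last by lia.
  split; rewrite /= ?g6 ?addn1 //; first by lia.
  by split; rewrite // g5 g0 h0 mulSn addnC.
- by split.
Qed.

Lemma filter_loopP n s m (f := fun m k => (imem m 4 k, rmem m 1 k)) :
  imem m 0 0 = n -> imem m 5 0 = s -> imem m 3 0 = 0 -> imem m 6 0 = 0 ->
  runs filter_loop m (fun t m' => t <= 100 * n + 100 /\
    [/\ imem m' 0 = imem m 0, rmem m' 0 = rmem m 0 &
        mkseq (f m') (imem m' 3 0) =
        [seq (j, rmem m 0 (s + j)) | j <- iota 0 n & rmem m 0 (s + j) != 0%R]]).
Proof.
move=> h0 h5 h3 h6.
pose l k := [seq (j, rmem m 0 (s + j)) | j <- iota 0 k & rmem m 0 (s + j) != 0%R].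
have lS k : l k.+1 = if rmem m 0 (s + k) != 0%R then
    rcons (l k) (k, rmem m 0 (s + k)) else l k.
  rewrite /l -(addn1 k) iotaD filter_cat map_cat add0n /=.
  by case: ifP; rewrite ?cats1 ?cats0.
pose I k m' := [/\ k <= n, imem m' 6 0 = k, imem m' 5 0 = s &
  [/\ imem m' 0 = imem m 0, rmem m' 0 = rmem m 0 & mkseq (f m') (imem m' 3 0) = l k]].
apply: runs_weaken (runs_while (pot := fun k => 90 * (n - k)) (I := I) (s := 0) _ _).
- move=> t m' [le_t [k [[le_k g6 g5 [g0 gr gl]]]]] /=; rewrite g0 h0 g6 => Nk.
  have <- : k = n by lia.
  by split=> //; move: le_t => /=; lia.
- move=> k m' [le_k g6 g5 [g0 gr gl]] /=; rewrite g0 h0 g6 => lt_k.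
  (* Writing at position [c] leaves the first [c] listed entries intact. *)
  have gS c (v : R) : mkseq (f (iupd (rupd (iupd m' 4 c k) 1 c v) 3 0 (c + 1))) c
     = mkseq (f m') c.
    apply/eq_in_map => j; rewrite mem_iota add0n /f /= => lt_j.
    by have -> : (j == c) = false by lia.
  apply: wp_runs => /=; rewrite g6 g5 gr -eq_le.
  have := lS k; case: eqVneq => v0 /= lk.
    exists k.+1; split; last by lia.
    split; rewrite /= ?g6 ?addn1 //; first by lia.
    by split=> //; rewrite lk -gl.
  rewrite ?g6 ?g5 ?gr; exists k.+1; split; last by lia.
  split; rewrite /= ?addn1 //; first by lia.
  split=> //.
  have := gS (imem m' 3 0) (rmem m 0 (s + k)).
  rewrite addn1 mkseqS lk -gl => H.
  by congr rcons; [exact: H | rewrite /f /= !eqxx].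
- by split=> //; rewrite h3.
Qed.

Lemma dense_enumerateP n (B : 'M[R]_n) m (i : 'I_n) : dense_stored B m ->
  runs dense_enumerate (iupd m 2 0 i) (fun t m' => t <= 200 * n + 200 /\
    dense_stored B m' /\
    [seq (imem m' 4 k, rmem m' 1 k) | k <- iota 0 (imem m' 3 0)]
    = row_entries B i).
Proof.
move=> [h0 hB].
apply: runs_seq; apply: wp_runs => /=; set m1 := iupd _ _ _ _.
apply: runs_seq; apply: runs_weaken (offset_loopP (m := m1) h0 (erefl _) _ _ _);
  rewrite ?(ltnW (ltn_ord i)) // => t2 m2 [le2 [g0 g5 gr]].
apply: runs_seq; apply: wp_runs => /=; set m3 := iupd _ _ _ _.
have m30 : imem m3 0 0 = n by rewrite /m3 /= g0.
apply: runs_weaken (filter_loopP m30 g5 (erefl _) (erefl _)).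
move=> t4 m4 [le4 [k0 kr kl]]; split; first by lia.
have rB a b : rmem m4 0 (a * n + b) = rmem m 0 (a * n + b).
  by rewrite kr /m3 /= gr.
split; first by split=> [|a b]; rewrite ?k0 // rB.
transitivity [seq (j, rmem m 0 (i * n + j)) | j <- iota 0 n
             & rmem m 0 (i * n + j) != 0%R].
  by move: kl; rewrite /m3 /= gr.
rewrite -val_enum_ord filter_map -map_comp /row_entries.
have -> : [seq j <- enum 'I_n | B i j != 0%R]
        = [seq j <- enum 'I_n | rmem m 0 (i * n + val j) != 0%R].
  by apply: eq_filter => j; rewrite hB.
by apply: eq_map => j /=; rewrite hB.
Qed.

Lemma dense_local n (B : 'M[R]_n) m m' :
  agree_below 7 m m' -> dense_stored B m -> dense_stored B m'.
Proof.
move=> A [h0 hB]; split; first by rewrite -(A 0 0 _).1.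
by move=> i j; rewrite -(A 0 _ _).2.
Qed.

End Dense.

(** * Quadratic time for dense arrays, linear time for sparse formats *)

Theorem mainTheorem5 (R : realType) :
  (exists (p : cmd) (K : nat),
     forall (n : nat) (B : 'M[R]_n) (m : memory R),
       0 < n -> substochastic B -> dense_stored B m ->
       outputs_within p m (K * n ^ 2) (con B))
  /\
  (forall (F : sparse_row_format R) (c : nat),
     exists (p : cmd) (K : nat),
     forall (n : nat) (B : 'M[R]_n) (m : memory R),
       0 < n -> substochastic B -> row_sparse B c -> stored F B m ->
       outputs_within p m (K * n) (con B)).
Proof.
split.
  (* The enumeration uses arrays 0 to 6. With [D = 200 * n + 200] and [e = n], the factor
     [D + e + 1] is at most [402 * n] since [n] is positive. *)
  exists (con_program 7 dense_enumerate 2 3 4 1), (1500 * 402).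
  move=> n B m n_gt0 _ SB.
  suff [t [m' [E le_t O]]] : outputs_within (con_program 7 dense_enumerate 2 3 4 1)
      m (1500 * (n * (200 * n + 200 + n + 1))) (con B).
    exists t, m'; split=> //; apply: leq_trans le_t _.
    rewrite -mulnA leq_mul2l /= expnS expn1 mulnCA leq_mul2l; lia.
  apply: (con_programP (S := dense_stored B)) => //.
  - by move=> m1 [].
  - exact: dense_local.
  - move=> m1 i /(dense_enumerateP i)[t [m2 [E [le_t [S2 P]]]]].
    by exists t, m2; rewrite P.
  - by move=> i; rewrite size_row_entries -[n in _ <= n]card_ord max_card.
move=> F c.
(* [w] exceeds the name of every array of the format, and the added 2 keeps it above the output
   array 1. *)
pose w := (width F + row_arg F + cnt_res F + col_res F + val_res F).+2.
exists (con_program w (enumerate F) (row_arg F) (cnt_res F) (col_res F) (val_res F)).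
(* Here [D = slope F * c + offset F] and [e = c], independent of [n]. *)
exists (1500 * (slope F * c + offset F + c + 1)) => n B m n_gt0 _ Bc SB.
have le_c i : size (row_entries B i) <= c by rewrite size_row_entries; exact: Bc.
rewrite -mulnA [_ * n]mulnC.
apply: (con_programP (S := stored F B)) => //.
- by rewrite /w; split; lia.
- by apply: below_leq (enumerate_below F); rewrite /w; lia.
- exact: stored_order.
- move=> m1 m2 A; apply: stored_local => a k lt_a; apply: A.
  by rewrite /w; lia.
- move=> m1 i /(enumerateP i)[t [m2 [E le_t S2 P]]].
  exists t, m2; split=> //; apply: leq_trans le_t _.
  by rewrite leq_add2r leq_mul2l le_c orbT.
Qed.
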